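(* Let $\mathcal{GO}=\langle t,\prec,\phi\rangle$ be a GOMT problem with $\phi$ satisfiable, and let $A_t=\{t^{\mathcal{I}}\mid \mathcal{I}\text{ is }\mathcal{GO}\text{-consistent}\}$. If $\prec$ is well-founded over $A_t$ (i.e., $A_t$ contains no infinite $\prec$-descending chain), then every $\mathcal{GO}$-derivation produced by a progressive derivation strategy reaches a saturated state (in particular, it is finite).
   Context: Fix a many-sorted first-order theory $\mathcal{T}$ (a signature $\Sigma$ together with a class of $\Sigma$-interpretations, the $\mathcal{T}$-interpretations) with equality, and an infinite set of sorted variables; all interpretations considered are $\mathcal{T}$-interpretations assigning a value to every variable, and $\models$ means $\models_{\mathcal{T}}$. A GOMT problem is a triple $\mathcal{GO}=\langle t,\prec,\phi\rangle$ where $t$ is a $\Sigma$-term of some sort $\sigma$, $\prec$ is a strict partial order on the values of sort $\sigma$ definable in $\mathcal{T}$, and $\phi$ is a $\Sigma$-formula. $\mathcal{I}$ is $\mathcal{GO}$-consistent if $\mathcal{I}\models\phi$; $\mathcal{I}<_{\mathcal{GO}}\mathcal{I}'$ if both are $\mathcal{GO}$-consistent and $t^{\mathcal{I}}\prec t^{\mathcal{I}'}$. $\textsc{Solve}$ maps a formula to an interpretation satisfying it if it is satisfiable, and to $\bot$ otherwise. $\textsc{Better}$ maps each $\mathcal{GO}$-consistent $\mathcal{I}$ to a formula such that for every $\mathcal{GO}$-consistent $\mathcal{I}'$: $\mathcal{I}'\models\textsc{Better}(\mathcal{I})$ iff $\mathcal{I}'<_{\mathcal{GO}}\mathcal{I}$.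 For a finite sequence $S=(s_1,\dots,s_n)$, $\textsc{Top}(S)=s_1$, $\textsc{Pop}(S)=(s_2,\dots,s_n)$, $\emptyset$ is the empty sequence, $\circ$ is concatenation. A state is $\langle\mathcal{I},\Delta,\tau\rangle$ ($\mathcal{I}$ an interpretation, $\Delta$ a formula, $\tau$ a finite sequence of formulas). Initial state: $\mathcal{I}_0=\textsc{Solve}(\phi)$, $\Delta_0=\textsc{Better}(\mathcal{I}_0)$, $\tau_0=(\Delta_0)$. Rules (unmentioned components unchanged): F-Split: if $\tau\neq\emptyset$, $\psi=\textsc{Top}(\tau)$, $\phi\models\psi\Leftrightarrow\bigvee_{j=1}^k\psi_j$ with $k\ge1$, then $\tau:=(\psi_1,\dots,\psi_k)\circ\textsc{Pop}(\tau)$. F-Sat: if $\tau\neq\emptyset$, $\psi=\textsc{Top}(\tau)$, $\textsc{Solve}(\phi\wedge\psi)=\mathcal{I}'\neq\bot$, $\Delta'=\Delta\wedge\textsc{Better}(\mathcal{I}')$, then $\mathcal{I}:=\mathcal{I}'$, $\Delta:=\Delta'$, $\tau:=(\Delta')$. F-Close: if $\tau\neq\emptyset$, $\psi=\textsc{Top}(\tau)$, $\textsc{Solve}(\phi\wedge\psi)=\bot$, then $\Delta:=\Delta\wedge\neg\psi$, $\tau:=\textsc{Pop}(\tau)$. A rule applies if its premises hold and the resulting state differs; a state is saturated if no rule applies. A $\mathcal{GO}$-derivation is a sequence of states starting at the initial state, each obtained from the previous by one rule. A derivation strategy (a policy for choosing rule applications) is progressive if it (i) never halts in a non-saturated state and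 (ii) uses F-Split only finitely many times in any derivation. *)

(* Defs.v *)
From Stdlib Require Import RelationClasses.
From mathcomp Require Import all_boot.

Set Implicit Arguments.
Unset Strict Implicit.
Unset Printing Implicit Defensive.

Record signature := Signature {
  sort : eqType;
  fsym : Type;
  f_arity : fsym -> nat;
  f_dom : forall f : fsym, 'I_(f_arity f) -> sort;
  f_cod : fsym -> sort;
  psym : Type;
  p_arity : psym -> nat;
  p_dom : forall p : psym, 'I_(p_arity p) -> sort
}.

Record variables (S : signature) := Variables {
  var :> sort S -> eqType;
  var_infinite : forall l : seq {s : sort S & var s}, exists z, z \notin l
}.

Definition svar (S : signature) (X : variables S) : eqType :=
  {s : sort S & X s}.

Definition to_svar (S : signature) (X : variables S) (s : sort S) (x : X s) :
  svar X := Tagged (fun s => X s) x.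

Inductive term (S : signature) (X : variables S) : sort S -> Type :=
| TVar (s : sort S) (x : X s) : term X s
| TApp (f : fsym S) (args : forall i : 'I_(f_arity f), term X (f_dom i)) :
    term X (f_cod f).

Inductive formula (S : signature) (X : variables S) : Type :=
| FFalse : formula X
| FEq (s : sort S) (t u : term X s) : formula X
| FPred (p : psym S) (args : forall i : 'I_(p_arity p), term X (p_dom i)) :
    formula X
| FNot (A : formula X) : formula X
| FAnd (A B : formula X) : formula X
| FOr (A B : formula X) : formula X
| FImp (A B : formula X) : formula X
| FIff (A B : formula X) : formula X
| FAll (s : sort S) (x : X s) (A : formula X) : formula X
| FEx (s : sort S) (x : X s) (A : formula X) : formula X.

Arguments FFalse {S X}.

Definition FBigOr (S : signature) (X : variables S) (l : seq (formula X)) :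
  formula X := foldr (@FOr S X) FFalse l.

Fixpoint free_term (S : signature) (X : variables S) (s : sort S)
    (t : term X s) (z : svar X) : Prop :=
  match t with
  | TVar _ x => z = to_svar x
  | TApp _ args => exists i, free_term (args i) z
  end.

Fixpoint free (S : signature) (X : variables S) (A : formula X) (z : svar X) :
    Prop :=
  match A with
  | FFalse => False
  | FEq _ t u => free_term t z \/ free_term u z
  | FPred _ args => exists i, free_term (args i) z
  | FNot B => free B z
  | FAnd B C | FOr B C | FImp B C | FIff B C => free B z \/ free C z
  | FAll _ x B | FEx _ x B => free B z /\ z <> to_svar x
  end.

(* Comparing values of a term under two different interpretations only makes
   sense inside a common collection [V s] of values of sort [s]. Each
   structure interprets [s] as a nonempty subset of [V s]; the subset may vary
   from one structure to another. *)
Record structure (S : signature) (V : sort S -> Type) := Structure {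
  in_dom : forall s : sort S, V s -> Prop;
  dom_nonempty : forall s : sort S, exists a : V s, in_dom a;
  f_int : forall f : fsym S,
    (forall i : 'I_(f_arity f), {a : V (f_dom i) | in_dom a}) ->
    {a : V (f_cod f) | in_dom a};
  p_int : forall p : psym S,
    (forall i : 'I_(p_arity p), {a : V (p_dom i) | in_dom a}) -> Prop
}.

Definition dom (S : signature) (V : sort S -> Type) (M : structure V)
  (s : sort S) : Type := {a : V s | in_dom M a}.

Definition valuation (S : signature) (X : variables S) (V : sort S -> Type)
  (M : structure V) : Type := forall z : svar X, dom M (tag z).

Definition update (S : signature) (X : variables S) (V : sort S -> Type)
    (M : structure V) (v : valuation X M) (s : sort S) (x : X s)
    (a : dom M s) : valuation X M :=
  dfwith v (i := to_svar x) a.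

Fixpoint eval (S : signature) (X : variables S) (V : sort S -> Type)
    (M : structure V) (v : valuation X M) (s : sort S) (t : term X s) :
    dom M s :=
  match t in term _ s return dom M s with
  | TVar _ x => v (to_svar x)
  | TApp f args => @f_int S V M f (fun i => eval v (args i))
  end.

Fixpoint holds (S : signature) (X : variables S) (V : sort S -> Type)
    (M : structure V) (v : valuation X M) (A : formula X) : Prop :=
  match A with
  | FFalse => False
  | FEq _ t u => eval v t = eval v u
  | FPred p args => @p_int S V M p (fun i => eval v (args i))
  | FNot B => ~ holds v B
  | FAnd B C => holds v B /\ holds v C
  | FOr B C => holds v B \/ holds v C
  | FImp B C => holds v B -> holds v C
  | FIff B C => holds v B <-> holds v C
  | FAll s x B => forall a : dom M s, holds (update v x a) B
  | FEx s x B => exists a : dom M s, holds (update v x a) B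
  end.

Record interp (S : signature) (X : variables S) (V : sort S -> Type) := Interp {
  i_struct : structure V;
  i_val : valuation X i_struct
}.

Record theory (S : signature) (X : variables S) := Theory {
  values : sort S -> Type;
  is_model : interp X values -> Prop
}.

Definition tinterp (S : signature) (X : variables S) (T : theory X) : Type :=
  {I : interp X (values T) | is_model I}.

Definition tstruct (S : signature) (X : variables S) (T : theory X)
  (I : tinterp T) : structure (values T) := i_struct (sval I).

Definition tval (S : signature) (X : variables S) (T : theory X)
  (I : tinterp T) : valuation X (tstruct I) := @i_val S X _ (sval I).

Definition tm_value (S : signature) (X : variables S) (T : theory X)
  (I : tinterp T) (s : sort S) (t : term X s) : values T s :=
  sval (eval (tval I) t).

Definition sat (S : signature) (X : variables S) (T : theory X)
  (I : tinterp T) (A : formula X) : Prop := holds (tval I) A.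

Definition satisfiable (S : signature) (X : variables S) (T : theory X)
  (A : formula X) : Prop := exists I : tinterp T, sat I A.

Definition entails (S : signature) (X : variables S) (T : theory X)
  (A B : formula X) : Prop := forall I : tinterp T, sat I A -> sat I B.

(* One parameter-free formula with two free variables defines the restriction
   of [R] to the domain of every model of the theory. *)
Definition definable (S : signature) (X : variables S) (T : theory X)
    (s : sort S) (R : values T s -> values T s -> Prop) : Prop :=
  exists (x y : X s) (D : formula X),
    [/\ x != y,
        forall z : svar X, free D z -> z = to_svar x \/ z = to_svar y
      & forall (I : tinterp T) (a b : dom (tstruct I) s),
          holds (update (update (tval I) x a) y b) D <-> R (sval a) (sval b)].

Record gomt (S : signature) (X : variables S) (T : theory X) := GOMT {
  go_sort : sort S;
  go_term : term X go_sort;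
  go_prec : values T go_sort -> values T go_sort -> Prop;
  go_strict : StrictOrder go_prec;
  go_definable : definable go_prec;
  go_phi : formula X
}.

Definition consistent (S : signature) (X : variables S) (T : theory X)
  (GO : gomt T) (I : tinterp T) : Prop := sat I (go_phi GO).

Definition go_lt (S : signature) (X : variables S) (T : theory X)
    (GO : gomt T) (I I' : tinterp T) : Prop :=
  [/\ consistent GO I, consistent GO I'
    & go_prec (tm_value I (go_term GO)) (tm_value I' (go_term GO))].

Definition attained (S : signature) (X : variables S) (T : theory X)
    (GO : gomt T) (a : values T (go_sort GO)) : Prop :=
  exists I : tinterp T, consistent GO I /\ tm_value I (go_term GO) = a.

Definition no_descending_chain (A : Type) (P : A -> Prop)
    (R : A -> A -> Prop) : Prop :=
  ~ exists a : nat -> A, forall n : nat, P (a n) /\ R (a n.+1) (a n).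

Definition is_solve (S : signature) (X : variables S) (T : theory X)
    (solve : formula X -> option (tinterp T)) : Prop :=
  forall A : formula X,
    match solve A with
    | Some J => sat J A
    | None => ~ satisfiable T A
    end.

Definition is_better (S : signature) (X : variables S) (T : theory X)
    (GO : gomt T) (better : tinterp T -> formula X) : Prop :=
  forall I I' : tinterp T, consistent GO I -> consistent GO I' ->
    (sat I' (better I) <-> go_lt GO I' I).

Record state (S : signature) (X : variables S) (T : theory X) := State {
  st_I : tinterp T;
  st_Delta : formula X;
  st_tau : seq (formula X)
}.

Definition initial (S : signature) (X : variables S) (T : theory X)
    (GO : gomt T) (solve : formula X -> option (tinterp T))
    (better : tinterp T -> formula X) (s : state T) : Prop :=
  exists I0 : tinterp T,
    solve (go_phi GO) = Some I0 /\ s = State I0 (better I0) [:: better I0].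

Inductive rule := F_Split | F_Sat | F_Close.

Inductive fires (S : signature) (X : variables S) (T : theory X)
    (GO : gomt T) (solve : formula X -> option (tinterp T))
    (better : tinterp T -> formula X) : rule -> state T -> state T -> Prop :=
| Fires_Split (I : tinterp T) (D psi : formula X) (tau psis : seq (formula X)) :
    psis <> [::] ->
    entails T (go_phi GO) (FIff psi (FBigOr psis)) ->
    fires GO solve better F_Split
      (State I D (psi :: tau)) (State I D (psis ++ tau))
| Fires_Sat (I I' : tinterp T) (D psi : formula X) (tau : seq (formula X)) :
    solve (FAnd (go_phi GO) psi) = Some I' ->
    fires GO solve better F_Sat
      (State I D (psi :: tau))
      (State I' (FAnd D (better I')) [:: FAnd D (better I')])
| Fires_Close (I : tinterp T) (D psi : formula X) (tau : seq (formula X)) :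
    solve (FAnd (go_phi GO) psi) = None ->
    fires GO solve better F_Close
      (State I D (psi :: tau)) (State I (FAnd D (FNot psi)) tau).

Definition applies (S : signature) (X : variables S) (T : theory X)
    (GO : gomt T) (solve : formula X -> option (tinterp T))
    (better : tinterp T -> formula X) (r : rule) (s s' : state T) : Prop :=
  fires GO solve better r s s' /\ s' <> s.

Definition saturated (S : signature) (X : variables S) (T : theory X)
    (GO : gomt T) (solve : formula X -> option (tinterp T))
    (better : tinterp T -> formula X) (s : state T) : Prop :=
  forall (r : rule) (s' : state T), ~ applies GO solve better r s s'.

(* A finite or infinite sequence of states, each step labelled by the rule
   used. [d_steps] is the number of steps, [None] standing for infinity; when
   it is [Some m] the states are [d_state 0], ..., [d_state m], the rules are
   [d_rule 0], ..., [d_rule m.-1], and all later values are irrelevant. *)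
Record trace (S : signature) (X : variables S) (T : theory X) := Trace {
  d_steps : option nat;
  d_state : nat -> state T;
  d_rule : nat -> rule
}.

Definition has_step (S : signature) (X : variables S) (T : theory X)
    (d : trace T) (n : nat) : Prop :=
  match d_steps d with
  | Some m => n < m
  | None => True
  end.

Definition derivation (S : signature) (X : variables S) (T : theory X)
    (GO : gomt T) (solve : formula X -> option (tinterp T))
    (better : tinterp T -> formula X) (d : trace T) : Prop :=
  initial GO solve better (d_state d 0) /\
  forall n : nat, has_step d n ->
    applies GO solve better (d_rule d n) (d_state d n) (d_state d n.+1).

(* The past of a derivation at its [n]-th state: the earlier states, each with
   the rule that was applied to it. *)
Definition history (S : signature) (X : variables S) (T : theory X)
    (d : trace T) (n : nat) : seq (state T * rule) :=
  mkseq (fun i => (d_state d i, d_rule d i)) n.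

(* [choose h s r s'] means that, with past [h] and current state [s], the
   strategy permits applying [r] to reach [s']. A strategy may be
   nondeterministic; it halts when it permits nothing. *)
Record strategy (S : signature) (X : variables S) (T : theory X)
    (GO : gomt T) (solve : formula X -> option (tinterp T))
    (better : tinterp T -> formula X) := Strategy {
  choose : seq (state T * rule) -> state T -> rule -> state T -> Prop;
  choose_applies : forall h s r s',
    choose h s r s' -> applies GO solve better r s s'
}.

Definition halts (S : signature) (X : variables S) (T : theory X)
    (GO : gomt T) (solve : formula X -> option (tinterp T))
    (better : tinterp T -> formula X) (st : strategy GO solve better)
    (h : seq (state T * rule)) (s : state T) : Prop :=
  forall (r : rule) (s' : state T), ~ choose st h s r s'.

(* A derivation produced by a strategy is a complete run of it: every step is
   permitted, and the derivation ends only where the strategy halts. *)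
Definition produced_by (S : signature) (X : variables S) (T : theory X)
    (GO : gomt T) (solve : formula X -> option (tinterp T))
    (better : tinterp T -> formula X) (st : strategy GO solve better)
    (d : trace T) : Prop :=
  [/\ derivation GO solve better d,
      forall n : nat, has_step d n ->
        choose st (history d n) (d_state d n) (d_rule d n) (d_state d n.+1)
    & forall n : nat, d_steps d = Some n ->
        halts st (history d n) (d_state d n)].

Definition progressive (S : signature) (X : variables S) (T : theory X)
    (GO : gomt T) (solve : formula X -> option (tinterp T))
    (better : tinterp T -> formula X) (st : strategy GO solve better) : Prop :=
  forall d : trace T, produced_by st d ->
    (forall n : nat, d_steps d = Some n ->
       saturated GO solve better (d_state d n)) /\
    (exists N : nat, forall n : nat,
       has_step d n -> d_rule d n = F_Split -> n < N).

(* Main.v *)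
Require Import Defs.
From mathcomp Require Import all_boot.

Set Implicit Arguments.
Unset Strict Implicit.
Unset Printing Implicit Defensive.

(** Every formula of a reachable state, [Delta] or in [tau], entails modulo
    [phi] that the incumbent is improved. Hence F-Sat strictly decreases the
    objective, while F-Close keeps the incumbent and shortens [tau]. Once the
    splits are exhausted, an infinite derivation therefore contains infinitely
    many F-Sat steps, whose objective values form an infinite descending chain
    in the attained values. *)

Lemma sat_FBigOr_cat (S : signature) (X : variables S) (T : theory X)
    (J : tinterp T) (l1 l2 : seq (formula X)) :
  sat J (FBigOr (l1 ++ l2)) <-> sat J (FBigOr l1) \/ sat J (FBigOr l2).
Proof.
elim: l1 => [|A l1 IH] /=; first by split=> [|[]] //; right.
rewrite /sat /= in IH *; tauto.
Qed.

(** Gathering [Delta] and [tau] into one disjunction lets a split of the top formula be handled by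
    rearranging disjuncts. *)
Definition sound_state (S : signature) (X : variables S) (T : theory X)
    (GO : gomt T) (s : state T) : Prop :=
  consistent GO (st_I s) /\
  forall J : tinterp T, consistent GO J ->
    sat J (FBigOr (st_Delta s :: st_tau s)) -> go_lt GO J (st_I s).

Section Steps.

Variables (S : signature) (X : variables S) (T : theory X) (GO : gomt T).
Variables (solve : formula X -> option (tinterp T)).
Variables (better : tinterp T -> formula X).
Hypotheses (solveP : is_solve solve) (betterP : is_better GO better).

Lemma solve_Some (A : formula X) (J : tinterp T) :
  solve A = Some J -> sat J A.
Proof. by move=> e; have := solveP A; rewrite e. Qed.

Lemma initial_sound (s : state T) :
  initial GO solve better s -> sound_state GO s.
Proof.
move=> [I0 [/solve_Some cI0 ->]]; split=> // J cJ /= JB.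
by apply: (betterP cI0 cJ).1; case: JB => // -[].
Qed.

(** F-Split replaces a disjunct by an equivalent disjunction modulo [phi]; after F-Sat both formulas
    have [better I'] as a conjunct; F-Close strengthens [Delta] and drops a disjunct. *)
Lemma fires_sound (r : rule) (s s' : state T) :
  fires GO solve better r s s' -> sound_state GO s -> sound_state GO s'.
Proof.
case=> [I D psi tau psis _ split_psi|I I' D psi tau /solve_Some|I D psi tau _];
    rewrite /sound_state /=.
- move=> [cI ltI]; split=> // J cJ JA; apply: ltI => //.
  have /= psiE := split_psi J cJ.
  case: JA => [|/sat_FBigOr_cat JA]; first by left.
  rewrite /sat /= in psiE JA *; tauto.
- move=> [cI' _] _; split=> // J cJ JA.
  by apply: (betterP cI' cJ).1; case: JA => [[]|[[]|[]]].
- move=> [cI ltI]; split=> // J cJ JA; apply: ltI => //.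
  rewrite /sat /= in JA *; tauto.
Qed.

Lemma F_Sat_decreases (s s' : state T) :
  fires GO solve better F_Sat s s' -> sound_state GO s ->
  go_lt GO (st_I s') (st_I s).
Proof.
move=> f; move e: F_Sat f => r f.
case: f e => // I I' D psi tau /solve_Some [cI' I'psi] _ [_ ltI].
(* The new incumbent satisfies [psi], the second disjunct of the invariant. *)
by apply: ltI => //; right; left.
Qed.

Lemma F_Close_shortens (s s' : state T) :
  fires GO solve better F_Close s s' ->
  st_I s' = st_I s /\ size (st_tau s') < size (st_tau s).
Proof. by move=> f; move e: F_Close f => r f; case: f e. Qed.

Variable d : trace T.
Hypotheses (d_deriv : derivation GO solve better d) (d_inf : d_steps d = None).

Lemma infinite_fires (n : nat) :
  fires GO solve better (d_rule d n) (d_state d n) (d_state d n.+1).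
Proof. by case: d_deriv => _ /(_ n); rewrite /has_step d_inf => /(_ I) []. Qed.

Lemma infinite_sound (n : nat) : sound_state GO (d_state d n).
Proof.
elim: n => [|n]; first by case: d_deriv => /initial_sound.
exact: fires_sound (infinite_fires n).
Qed.

(** The witness is informative, found by inspecting [d_rule], so that it can be iterated into a
    sequence without a choice axiom. *)
Lemma next_improvement (N : nat) :
  (forall n, N <= n -> d_rule d n <> F_Split) ->
  forall n, N <= n ->
    {m | N <= m & go_lt GO (st_I (d_state d m)) (st_I (d_state d n))}.
Proof.
move=> noSplit n.
(* The length of [tau] bounds the number of consecutive F-Close steps before an F-Sat. *)
have [k] := ubnP (size (st_tau (d_state d n))).
elim: k n => // k IH n le_k Nn; have f := infinite_fires n.
case r: (d_rule d n) f => f; first by case: (noSplit n Nn).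
  by exists n.+1; [exact: leqW | exact: F_Sat_decreases f (infinite_sound n)].
have [eI lt_size] := F_Close_shortens f.
have [||m Nm lt_m] := IH n.+1; [exact: leq_trans lt_size _ | exact: leqW |].
by exists m; rewrite // -eI.
Qed.

Lemma no_infinite_derivation (N : nat) :
  (forall n, N <= n -> d_rule d n <> F_Split) ->
  ~ no_descending_chain (attained (GO := GO)) (@go_prec S X T GO).
Proof.
move=> /next_improvement next; apply.
(* Indices carry the bound [N <= n], under which [next] can be applied again. *)
pose step (p : {n | N <= n}) : {n | N <= n} :=
  let: exist2 m Nm _ := next (sval p) (svalP p) in exist _ m Nm.
pose idx i := iter i step (exist _ N (leqnn N)).
exists (fun i => tm_value (st_I (d_state d (sval (idx i)))) (go_term GO)) => i.
split.
  exists (st_I (d_state d (sval (idx i)))); split=> //.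
  exact: (infinite_sound _).1.
by rewrite /idx iterS -/(idx i) {1}/step; case: (next _ _) => m Nm [].
Qed.

End Steps.

Theorem theorem2 (S : signature) (X : variables S) (T : theory X)
    (GO : gomt T) (solve : formula X -> option (tinterp T))
    (better : tinterp T -> formula X) :
  is_solve solve ->
  is_better GO better ->
  satisfiable T (go_phi GO) ->
  no_descending_chain (attained (GO := GO)) (@go_prec S X T GO) ->
  forall st : strategy GO solve better, progressive st ->
  forall d : trace T, produced_by st d ->
  exists n : nat,
    d_steps d = Some n /\ saturated GO solve better (d_state d n).
Proof.
move=> solveP betterP _ wf st prog d dP.
have [sat_end [N splitN]] := prog d dP.
case e: (d_steps d) => [n|]; first by exists n; split=> //; exact: sat_end.
have [d_deriv _ _] := dP.
(* In an infinite trace every index has a step, so [splitN] excludes splits from [N] on. *)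
case: (@no_infinite_derivation _ _ _ _ _ _ solveP betterP d d_deriv e N _ wf).
move=> n Nn /splitN; rewrite /has_step e => /(_ I).
by rewrite ltnNge Nn.
Qed.
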